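(* Let $G$ be a multigraph (multiple edges allowed, no loops) with maximum degree $\Delta(G)$, and let the palette be $\mathcal{K}=\{1,\dots,\lfloor \tfrac32\Delta(G)+\tfrac12\rfloor\}$. Let $M\subseteq E(G)$ be a matching whose edges are assigned arbitrary colours from $\mathcal{K}$. Then this precolouring can be extended to a proper edge-colouring of all of $G$ using only colours from $\mathcal{K}$.
   Context: A proper edge-colouring assigns colours to edges so that any two edges sharing an end-vertex (including parallel edges) receive distinct colours. Extending a precolouring means producing a proper edge-colouring of all of $G$ agreeing with the given colours on the precoloured edges. *)

(* Defs.v *)
From mathcomp Require Import all_boot.

Set Implicit Arguments.
Unset Strict Implicit.
Unset Printing Implicit Defensive.

(* Parallel edges are distinct elements of [edge] with the same set of ends;
   [card_ends] excludes loops. *)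
Record multigraph := Multigraph {
  vertex : finType;
  edge : finType;
  ends : edge -> {set vertex};
  card_ends : forall e, #|ends e| = 2
}.

Definition degree (G : multigraph) (v : vertex G) : nat :=
  #|[set e : edge G | v \in ends e]|.

Definition max_degree (G : multigraph) : nat :=
  \max_(v : vertex G) degree v.

Definition adjacent_edges (G : multigraph) (e f : edge G) : bool :=
  (e != f) && [exists v, (v \in ends e) && (v \in ends f)].

Definition matching (G : multigraph) (M : {set edge G}) : Prop :=
  {in M &, forall e f, ~~ adjacent_edges e f}.

Definition proper_edge_colouring (G : multigraph) (c : edge G -> nat) : Prop :=
  forall e f : edge G, adjacent_edges e f -> c e <> c f.

(* floor (3/2 * D + 1/2) = (3 * D + 1) %/ 2 for natural D *)
Definition palette (G : multigraph) : pred nat :=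
  [pred k | 1 <= k <= (3 * max_degree G + 1) %/ 2].

(* Main.v *)
(* Take a maximum cut of the graph without [M]. Every vertex then meets at most
   [(D + 1) / 2] edges that are in [M] or uncut, [D] being the maximum degree, so
   these edges can be coloured greedily. Remove from the palette, which has
   [D + (D + 1) / 2] colours, those seen at the ends of a cut edge [uv]: the
   number of colours left is at least the larger of the numbers of cut edges at
   [u] and at [v]. Such lists suffice in a bipartite multigraph (Borodin, Kostochka
   and Woodall): König's theorem applied repeatedly ranks the edges at each
   vertex so that every edge [uv] is preceded by fewer than [max (d u) (d v)]
   edges in total, and Galvin's stable matching argument then colours the edges
   from their lists. *)

Require Import Defs.
From mathcomp Require Import all_boot.
From mathcomp Require Import zify.

Set Implicit Arguments.
Unset Strict Implicit.
Unset Printing Implicit Defensive.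

(** * Rankings of the edges at their ends on one side of a bipartition *)

Section Preferences.

Variables (E A : finType) (h : E -> A).
Implicit Types (S N : {set E}) (C : {set A}) (k : E -> nat).

Definition fibre S x := [set e in S | h e == x].

(** With [h e] read as the end of [e] on one side, these are the edges ranked ahead of [e] at that
    vertex; smaller keys come first. *)
Definition preferred S k e := [set f in fibre S (h e) | k f < k e].

Definition distinguishes S k :=
  {in S &, forall e f, h e = h f -> k e = k f -> e = f}.

Lemma card_fibre_matching N x :
  {in N &, injective h} -> #|fibre N x| = (x \in h @: N).
Proof.
move=> injN; case: imsetP => [[e eN ->]|noN].
  rewrite (_ : fibre N _ = [set e]) ?cards1 //.
  apply/setP=> f; rewrite !inE; apply/andP/eqP => [[fN /eqP hf]|->//].
  exact: injN.
apply: eq_card0 => e; rewrite !inE; apply/negP=> /andP[eN /eqP he].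
by case: noN; exists e.
Qed.

Lemma card_fibre_setD S N x :
  N \subset S -> {in N &, injective h} ->
  #|fibre S x| = #|fibre (S :\: N) x| + (x \in h @: N).
Proof.
move=> sNS injN; rewrite -card_fibre_matching // addnC.
rewrite -(cardsID N (fibre S x)); congr (_ + _); apply: eq_card => e.
  rewrite !inE andbC andbA; case: (boolP (e \in N)) => //= eN.
  by rewrite (subsetP sNS).
by rewrite !inE andbA.
Qed.

(** At each vertex the edge of [N] is ranked last if the vertex is in [C], first otherwise. Shifting
    the old keys by one frees [0] and leaves them below the maximum plus two. *)
Definition insert_key N C k e :=
  if e \in N then if h e \in C then (\max_f k f).+2 else 0 else (k e).+1.

Lemma insert_key_distinguishes S N C k :
  {in N &, injective h} -> distinguishes (S :\: N) k ->
  distinguishes S (insert_key N C k).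
Proof.
move=> injN dk e f eS fS hef; rewrite /insert_key.
have le_max g : k g <= \max_f k f by exact: leq_bigmax.
case: (boolP (e \in N)) => eN; case: (boolP (f \in N)) => fN.
- by move=> _; apply: injN.
- by case: ifP => _ // [] kf; have := le_max f; rewrite -kf ltnn.
- by case: ifP => _ // [] ke; have := le_max e; rewrite ke ltnn.
by case; apply: dk => //; rewrite inE ?eN ?fN.
Qed.

Lemma preferred_lt_fibre S k e : e \in S -> #|preferred S k e| < #|fibre S (h e)|.
Proof.
move=> eS; apply: proper_card; apply/properP; split.
  by apply/subsetP=> f; rewrite inE => /andP[].
by exists e; rewrite !inE ?eS ?eqxx // ltnn.
Qed.

Lemma preferred_insert_first S N C k e :
  e \in N -> h e \notin C -> #|preferred S (insert_key N C k) e| = 0.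
Proof.
move=> eN eC; apply: eq_card0 => f.
by rewrite !inE {2}/insert_key eN (negPf eC) ltn0 andbF.
Qed.

(** The only possible new competitor is the single edge of [N] at the same vertex, and it precedes
    [e] only when it is ranked first. *)
Lemma preferred_insert S N C k e :
  {in N &, injective h} -> e \in S :\: N ->
  #|preferred S (insert_key N C k) e| <=
  #|preferred (S :\: N) k e| + ((h e \in h @: N) && (h e \notin C)).
Proof.
move=> injN; rewrite inE => /andP[eN eS].
have -> : ((h e \in h @: N) && (h e \notin C) : nat) =
          #|[set f in fibre N (h e) | h e \notin C]|.
  case: (boolP (h e \in C)) => _; rewrite /= ?andbT ?andbF -?card_fibre_matching //.
    by symmetry; apply: eq_card0 => f; rewrite !inE andbF.
  by apply: eq_card => f; rewrite !inE andbT.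
apply: leq_trans (leq_card_setU _ _); apply: subset_leq_card.
apply/subsetP=> f; rewrite !inE /insert_key (negPf eN).
case/andP=> /andP[fS /eqP hf]; rewrite fS hf eqxx /=.
have [fN|fN] := boolP (f \in N); rewrite /= ?orbF //.
case: ifP => //= _; rewrite ltnS => lt_max.
by have := leq_trans lt_max (leq_bigmax e); rewrite ltnNge leqnSn.
Qed.

End Preferences.

(** * König's theorem, stable matchings and list colouring in bipartite multigraphs *)

Section Bipartite.

Variables (E A B : finType) (a : E -> A) (b : E -> B).
Implicit Types (S N : {set E}).

(** [N] is a maximum matching and [R] plays the role of the vertices on the [a] side reachable by
    alternating paths from unmatched ones; the cover consists of the complement of [R] and the
    neighbours of [R]. *)
Lemma konig_matching_cover S :
  exists N (CA : {set A}) (CB : {set B}),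
    [/\ N \subset S, {in N &, injective a} & {in N &, injective b}] /\
    [/\ {in S, forall e, (a e \in CA) || (b e \in CB)},
        {in N, forall e, (a e \in CA) (+) (b e \in CB)},
        CA \subset a @: N & CB \subset b @: N].
Proof.
pose mat N := [&& N \subset S, dinjectiveb a N & dinjectiveb b N].
have matP N : reflect [/\ N \subset S, {in N &, injective a}
                        & {in N &, injective b}] (mat N).
  apply: (iffP and3P) => [] [sN /dinjectiveP ia /dinjectiveP ib]; by split.
have mat0 : mat set0.
  by apply/matP; split=> [|e f|e f]; rewrite ?sub0set ?inE.
case: (@arg_maxnP _ set0 mat (fun N => #|N|) mat0) => N matN maxN.
(* [R] collects vertices that some matching with the same [b]-ends as [N]
   avoids; agreement with [N] outside [R] lets [R] grow one vertex at a time
   along alternating paths, without ever manipulating the paths. *)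
pose good (R : {set A}) := [forall v in R, [exists N' : {set E},
  [&& mat N', b @: N' == b @: N, v \notin a @: N'
    & [forall e in N, (a e \notin R) ==> (e \in N')]]]].
have goodP (R : {set A}) : reflect (forall v, v \in R -> exists N',
    [/\ mat N', b @: N' = b @: N, v \notin a @: N'
      & forall e, e \in N -> a e \notin R -> e \in N']) (good R).
  apply: (iffP forall_inP) => H v /H.
    case/existsP=> N' /and4P[m /eqP eb va /forall_inP ag].
    by exists N'; split=> // e eN; apply/implyP/ag.
  case=> N' [m eb va ag]; apply/existsP; exists N'; rewrite m eb eqxx va /=.
  by apply/forall_inP=> e eN; apply/implyP/ag.
have good0 : good set0 by apply/goodP=> v; rewrite inE.
have [R /maxsetP[/goodP gR maxR] _] := maxset_exists good0.
have [sNS ia ib] := matP _ matN.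
have grow v : (exists N', [/\ mat N', b @: N' = b @: N, v \notin a @: N'
      & forall e, e \in N -> a e \notin v |: R -> e \in N']) -> v \in R.
  move=> Hv; rewrite -(maxR (v |: R)) ?setU11 ?subsetUr //.
  apply/goodP=> w; case/setU1P=> [->//|wR].
  have [N' [m eb wa ag]] := gR w wR; exists N'; split=> // e eN.
  by rewrite inE negb_or => /andP[_]; apply: ag.
have unc v : v \notin a @: N -> v \in R by move=> vN; apply: grow; exists N.
(* Otherwise [f] could be added to a matching as large as [N] that avoids [a f]. *)
have nbr f : f \in S -> a f \in R -> b f \in b @: N.
  move=> fS fR; apply: contraT => fN.
  have [N' [/matP[sN' ia' ib'] eb fa _]] := gR _ fR.
  have fbN' : b f \notin b @: N' by rewrite eb.
  have fN' : f \notin N' by apply: contra fa => ?; apply: imset_f.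
  have : mat (f |: N').
    apply/matP; split; first by rewrite subUset sub1set fS.
    - move=> x y /setU1P[->|xN] /setU1P[->|yN] // e.
      + by case/imsetP: fa; exists y.
      + by case/imsetP: fa; exists x.
      + exact: ia'.
    - move=> x y /setU1P[->|xN] /setU1P[->|yN] // e.
      + by case/imsetP: fbN'; exists y.
      + by case/imsetP: fbN'; exists x.
      + exact: ib'.
  move/maxN; rewrite /= cardsU1 fN'.
  by rewrite -(card_in_imset ib') eb (card_in_imset ib) /= add1n ltnn.
(* In a matching avoiding [a f], exchanging [e] for [f] frees [a e] and keeps the [b]-ends. *)
have alt e f : e \in N -> f \in S -> b f = b e -> a f \in R -> a e \in R.
  move=> eN fS bef fR; apply: contraT => eR.
  have [N' [/matP[sN' ia' ib'] eb fa ag]] := gR _ fR.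
  have eN' : e \in N' by apply: ag.
  case/negP: (eR); apply: grow; exists (f |: (N' :\ e)).
  have naf x : x \in N' -> a x <> a f.
    by move=> xN' ax; case/imsetP: fa; exists x.
  split.
  - apply/matP; split.
    + by rewrite subUset sub1set fS (subset_trans (subsetDl _ _)).
    + move=> x y /setU1P[->|/setD1P[xe xN]] /setU1P[->|/setD1P[ye yN]] //.
      * by move/esym/(naf _ yN).
      * by move/(naf _ xN).
      * exact: ia'.
    + move=> x y /setU1P[->|/setD1P[xe xN]] /setU1P[->|/setD1P[ye yN]] //.
      * by rewrite bef => /ib' ey; rewrite -ey ?eqxx in ye.
      * by rewrite bef => /ib' ey; rewrite ey ?eqxx in xe.
      * exact: ib'.
  - by rewrite imsetU1 bef -imsetU1 setD1K.
  - apply/imsetP=> -[x /setU1P[->|/setD1P[xe xN]]] ex.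
      by rewrite ex fR in eR.
    by rewrite (ia' _ _ eN' xN ex) eqxx in xe.
  - move=> x xN; rewrite !inE negb_or => /andP[nx xR]; rewrite ag // andbT.
    by apply/orP; right; apply: contraNneq nx => ->.
exists N, (~: R), [set b f | f in [set f in S | a f \in R]]; split=> //; split.
- move=> e eS; rewrite inE; case: (boolP (a e \in R)) => //= eR.
  by apply: imset_f; rewrite inE eS.
- move=> e eN; rewrite inE; case: (boolP (a e \in R)) => eR /=.
    by apply: imset_f; rewrite inE eR (subsetP sNS).
  apply/imsetP=> -[f]; rewrite inE => /andP[fS fR] bef.
  by rewrite (alt e f) in eR.
- apply/subsetP=> v; rewrite inE; apply: contraR; exact: unc.
- apply/subsetP=> y /imsetP[f]; rewrite inE => /andP[fS fR] ->; exact: nbr.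
Qed.

(* Edges of a König matching are ranked last at their end in the cover and first
   at the other end; every other edge gains a competitor only if both of its
   ends lose one from their degree. *)
Lemma preferences_exist S :
  exists ka kb : E -> nat,
    [/\ distinguishes a S ka, distinguishes b S kb
      & {in S, forall e, #|preferred a S ka e| + #|preferred b S kb e| <
                         maxn #|fibre a S (a e)| #|fibre b S (b e)|}].
Proof.
have [n] := ubnP #|S|; elim: n S => // n IHn S ltSn.
have [->|[e0 e0S]] := set_0Vmem S.
  by exists (fun=> 0), (fun=> 0); split=> [e f|e f|e]; rewrite inE.
have [N [CA [CB [[sNS ia ib] [cov xcov sCA sCB]]]]] := konig_matching_cover S.
have [e1 e1N] : exists e, e \in N.
  have /orP[/(subsetP sCA)/imsetP[e eN _]|/(subsetP sCB)/imsetP[e eN _]] :=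
    cov e0 e0S; by exists e.
have ltD : #|S :\: N| < n.
  rewrite -ltnS; apply: leq_trans ltSn; rewrite ltnS.
  apply: proper_card; apply/properP; split; first exact: subsetDl.
  by exists e1; rewrite ?inE ?e1N // (subsetP sNS).
have [ka [kb [da db lt]]] := IHn _ ltD.
exists (insert_key a N CA ka), (insert_key b N CB kb).
split; [exact: insert_key_distinguishes|exact: insert_key_distinguishes|].
move=> e eS; have [eN|eN] := boolP (e \in N).
  have la := preferred_lt_fibre a (insert_key a N CA ka) eS.
  have lb := preferred_lt_fibre b (insert_key b N CB kb) eS.
  (* At its end outside the cover [e] is ranked first, so only the other end contributes. *)
  have := xcov e eN; case: (boolP (a e \in CA)) => eA /= => [eB|_].
    by rewrite (preferred_insert_first _ _ eN eB) addn0 leq_max la.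
  by rewrite (preferred_insert_first _ _ eN eA) add0n leq_max lb orbT.
have eD : e \in S :\: N by rewrite inE eN.
have pa := preferred_insert CA ka ia eD.
have pb := preferred_insert CB kb ib eD.
have := lt e eD; have := cov e eS.
have := subsetP sCA (a e); have := subsetP sCB (b e).
rewrite (card_fibre_setD (a e) sNS ia) (card_fibre_setD (b e) sNS ib).
move: pa pb; case: (a e \in CA); case: (b e \in CB);
  case: (a e \in a @: N); case: (b e \in b @: N) => //=;
  by [lia | move=> _ _ /(_ isT) | move=> _ _ _ /(_ isT)].
Qed.

(** Gale and Shapley's argument by deletion: if two edges that are best at their [a]-ends share a
    [b]-end, the one ranked lower there is discarded; once no such pair is left, the best edges form
    the matching. *)
Lemma stable_matching S (ka kb : E -> nat) :
  distinguishes a S ka -> distinguishes b S kb ->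
  exists N, [/\ N \subset S, {in N &, injective a}, {in N &, injective b}
    & {in S :\: N, forall e, exists2 f, f \in N &
        (f \in preferred a S ka e) || (f \in preferred b S kb e)}].
Proof.
have [n] := ubnP #|S|; elim: n S => // n IHn S ltSn da db.
pose best e := (e \in S) && [forall f in S, (a f == a e) ==> (ka e <= ka f)].
have bestP e : reflect (e \in S /\ forall f, f \in S -> a f = a e -> ka e <= ka f)
                       (best e).
  apply: (iffP andP) => -[eS H]; split=> //.
    by move=> f fS /eqP; apply/implyP; move/forall_inP: H; apply.
  by apply/forall_inP=> f fS; apply/implyP=> /eqP; apply: H.
have [/'exists_existsP[e [f /and5P[be bf ef /eqP bef kef]]]|none] := boolP
    [exists e, exists f, [&& best e, best f, e != f, b e == b f & kb e < kb f]].
  have [eS emin] := bestP _ be; have [fS fmin] := bestP _ bf.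
  have sDS : S :\ f \subset S by apply: subsetDl.
  have ltD : #|S :\ f| < n by move: ltSn; rewrite (cardsD1 f S) fS.
  have [||N [sN ia ib dom]] := IHn (S :\ f) ltD.
  - by move=> x y xS yS; apply: da; apply: (subsetP sDS).
  - by move=> x y xS yS; apply: db; apply: (subsetP sDS).
  exists N; split=> //; first exact: subset_trans sDS.
  move=> x; rewrite inE => /andP[xN xS].
  have [->|xf] := eqVneq x f.
    (* The discarded [f] loses to [e]. If [e] is not in [N], the edge of [N] beating it does so at
       the [b]-end, [e] being best at its [a]-end, and so beats [f] as well. *)
    have [eN|eN] := boolP (e \in N).
      by exists e => //; rewrite !inE eS bef eqxx kef orbT.
    have [|g gN] := dom e; first by rewrite !inE eN ef.
    rewrite !inE => /orP[|] /andP[/andP[/andP[_ gS] /eqP hg] kg].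
      by have := emin g gS hg; rewrite leqNgt kg.
    by exists g => //; rewrite !inE gS hg bef eqxx (ltn_trans kg kef) orbT.
  have [|g gN gx] := dom x; first by rewrite !inE xN xf.
  exists g => //; move: gx; rewrite !inE.
  by case: (g \in S); rewrite ?andbF ?andbT //=; case: (g != f).
exists [set e | best e]; split.
- by apply/subsetP=> e; rewrite inE => /bestP[].
- move=> e f; rewrite !inE => /bestP[eS em] /bestP[fS fm] aef.
  by apply: (da e f) => //; apply/eqP; rewrite eqn_leq em ?fm.
- move=> e f; rewrite !inE => be bf bef; apply/eqP; apply: contraNT none => ef.
  have [eS _] := bestP _ be; have [fS _] := bestP _ bf.
  have : kb e != kb f by apply: contra ef => /eqP/(db e f eS fS bef)/eqP.
  rewrite neq_ltn => /orP[k|k]; apply/existsP.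
    by exists e; apply/existsP; exists f; rewrite be bf ef bef eqxx.
  by exists f; apply/existsP; exists e; rewrite be bf eq_sym ef bef eqxx.
move=> e; rewrite !inE => /andP[nbe eS].
case: (@arg_minnP _ e (fun f => (f \in S) && (a f == a e)) ka).
  by rewrite eS eqxx.
move=> f /andP[fS /eqP afe] fm.
have bf : best f.
  by apply/bestP; split=> // g gS ag; apply: fm; rewrite gS ag afe eqxx.
exists f; rewrite ?inE // fS afe eqxx /=; apply/orP; left.
rewrite ltn_neqAle fm ?eS ?eqxx // andbT; apply: contra nbe => /eqP kfe.
by rewrite -(da f e).
Qed.

(* Galvin's argument: a colour class is a stable matching among the edges whose
   list has that colour, so each edge losing the colour also loses a preferred
   neighbour. *)
Lemma list_colouring_of_preferences (C : finType) (c0 : C) (L : E -> {set C})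
    (ka kb : E -> nat) S :
  distinguishes a S ka -> distinguishes b S kb ->
  {in S, forall e, #|preferred a S ka e| + #|preferred b S kb e| < #|L e|} ->
  exists c : E -> C, {in S, forall e, c e \in L e} /\
    {in S &, forall e f, e != f -> (a e == a f) || (b e == b f) -> c e != c f}.
Proof.
have [n] := ubnP #|S|; elim: n S L => // n IHn S L ltSn da db ltL.
have [->|[e0 e0S]] := set_0Vmem S.
  by exists (fun=> c0); split=> [e|e f]; rewrite inE.
have /card_gt0P[k kL] : 0 < #|L e0| by apply: leq_ltn_trans (ltL _ e0S).
pose T := [set e in S | k \in L e].
have sTS : T \subset S by apply/subsetP=> e; rewrite inE => /andP[].
have e0T : e0 \in T by rewrite inE e0S.
have [||N [sNT ia ib dom]] := @stable_matching T ka kb.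
- by move=> x y xS yS; apply: da; apply: (subsetP sTS).
- by move=> x y xS yS; apply: db; apply: (subsetP sTS).
have sNS := subset_trans sNT sTS.
have [e1 e1N] : exists e, e \in N.
  have [e0N|e0N] := boolP (e0 \in N); first by exists e0.
  by have [|f fN _] := dom e0; [rewrite inE e0N|exists f].
have sDS : S :\: N \subset S by apply: subsetDl.
have ltD : #|S :\: N| < n.
  rewrite -ltnS; apply: leq_trans ltSn; rewrite ltnS.
  apply: proper_card; apply/properP; split=> //.
  by exists e1; rewrite ?inE ?e1N // (subsetP sNS).
have sub (X : finType) (h : E -> X) q e :
    preferred h (S :\: N) q e \subset preferred h S q e.
  by apply/subsetP=> f; rewrite !inE -!andbA => /and4P[_ -> -> ->].
have strict (X : finType) (h : E -> X) q e f : f \in N ->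
    f \in preferred h T q e ->
    #|preferred h (S :\: N) q e| < #|preferred h S q e|.
  move=> fN; rewrite !inE -!andbA => /and4P[fS _ hf kf].
  apply: proper_card; apply/properP; split=> //.
  by exists f; rewrite !inE ?fN // fS hf kf.
have [|||c [cL cP]] := IHn (S :\: N) (fun e => L e :\ k) ltD.
- by move=> x y xS yS; apply: da; apply: (subsetP sDS).
- by move=> x y xS yS; apply: db; apply: (subsetP sDS).
- move=> e; rewrite inE => /andP[eN eS].
  have := ltL e eS; rewrite (cardsD1 k (L e)).
  have la := subset_leq_card (sub _ a ka e).
  have lb := subset_leq_card (sub _ b kb e).
  case: (boolP (k \in L e)) => /= kLe; last by lia.
  have [|f fN] := dom e; first by rewrite !inE eN eS.
  by case/orP=> /(strict _ _ _ _ _ fN); lia.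
exists (fun e => if e \in N then k else c e); split.
  move=> e eS; case: ifP => eN.
    by move/(subsetP sNT): eN; rewrite inE => /andP[].
  by have := cL e; rewrite !inE eN => /(_ eS)/andP[].
have ck e : e \in S -> e \notin N -> c e != k.
  by move=> eS eN; have := cL e; rewrite !inE eN eS => /(_ isT)/andP[].
move=> e f eS fS ef adj; case: ifPn => eN; case: ifPn => fN.
- case/orP: adj => /eqP adj; case/eqP: ef; by [apply: ia|apply: ib].
- by rewrite eq_sym ck.
- exact: ck.
- by apply: cP; rewrite ?inE ?eN ?fN.
Qed.

Lemma bipartite_list_colouring (C : finType) (c0 : C) (L : E -> {set C}) S :
  {in S, forall e, maxn #|fibre a S (a e)| #|fibre b S (b e)| <= #|L e|} ->
  exists c : E -> C, {in S, forall e, c e \in L e} /\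
    {in S &, forall e f, e != f -> (a e == a f) || (b e == b f) -> c e != c f}.
Proof.
move=> leL; have [ka [kb [da db lt]]] := preferences_exist S.
apply: (list_colouring_of_preferences c0 da db) => e eS.
exact: leq_trans (lt e eS) (leL e eS).
Qed.

End Bipartite.

(** * Balanced cuts and greedy colouring in multigraphs *)

Section Multigraph.

Variable G : multigraph.
Implicit Types (S R P M : {set edge G}) (e f : edge G) (v : vertex G).

Definition incident S v := [set e in S | v \in ends e].

Lemma card_incident_setD S R v :
  S \subset R -> #|incident R v| = #|incident S v| + #|incident (R :\: S) v|.
Proof.
move=> sSR; rewrite -(cardsID S (incident R v)); congr (_ + _).
  apply: eq_card => e; rewrite !inE andbC andbA.
  by case: (boolP (e \in S)) => //= eS; rewrite (subsetP sSR).
by apply: eq_card => e; rewrite !inE andbA.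
Qed.

Lemma card_incident_matching M v : matching M -> #|incident M v| <= 1.
Proof.
move=> mM; rewrite leqNgt; apply/negP=> /card_gt1P[e [f []]].
rewrite !inE => /andP[eM ev] /andP[fM fv] ef.
have /negP := mM e f eM fM; apply; rewrite /adjacent_edges ef /=.
by apply/existsP; exists v; rewrite ev.
Qed.

Lemma card_incident_le_max_degree v : #|incident setT v| <= max_degree G.
Proof.
rewrite (_ : #|_| = degree v) ?(leq_bigmax v) //.
by apply: eq_card => e; rewrite !inE.
Qed.

Lemma adjacent_edges_sym e f : adjacent_edges e f = adjacent_edges f e.
Proof.
rewrite /adjacent_edges eq_sym; congr (_ && _).
by apply: eq_existsb => v; rewrite andbC.
Qed.

Lemma ends_pair : exists s t : edge G -> vertex G, forall e, ends e = [set s e; t e].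
Proof.
have /fin_all_exists[st stP] e : exists st : vertex G * vertex G,
    ends e = [set st.1; st.2].
  have /eqP/cards2P[x [y [_ ->]]] := card_ends e.
  by exists (x, y).
by exists (fun e => (st e).1), (fun e => (st e).2).
Qed.

Lemma ends_pair_neq e x y : ends e = [set x; y] -> x != y.
Proof. by move=> exy; have := card_ends e; rewrite exy cards2; case: eqP. Qed.

(* A maximum cut: moving [v] to the other side swaps the cut and uncut edges at
   [v]. *)
Lemma balanced_cut R :
  exists S (X : {set vertex G}) (a b : edge G -> vertex G),
    [/\ S \subset R, forall e, ends e = [set a e; b e],
        {in S, forall e, (a e \in X) && (b e \notin X)}
      & forall v, #|incident (R :\: S) v| <= #|incident S v|].
Proof.
have [s [t stP]] := ends_pair.
pose cut (X : {set vertex G}) := [set e in R | (s e \in X) (+) (t e \in X)].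
case: (@arg_maxnP _ (set0 : {set vertex G}) predT (fun X => #|cut X|) isT).
move=> X _ maxX.
exists (cut X), X, (fun e => if s e \in X then s e else t e),
  (fun e => if s e \in X then t e else s e); split.
- by apply/subsetP=> e; rewrite inE => /andP[].
- by move=> e; rewrite stP; case: ifP => // _; rewrite setUC.
- move=> e; rewrite inE => /andP[_].
  by case: ifPn => sX /=; rewrite ?(negPf sX) ?sX /= => ->.
move=> v; pose X' := [set x | (x \in X) (+) (x == v)].
(* The two ends of an edge differ, so moving [v] changes the status of every edge at [v]. *)
have cutX' e : (e \in cut X') = (e \in R) && ((e \in cut X) (+) (v \in ends e)).
  rewrite !inE; case: (e \in R) => //=.
  have := ends_pair_neq (stP e); rewrite stP !inE [v == s e]eq_sym [v == t e]eq_sym.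
  case: (eqVneq (s e) v) => [->|_]; case: (eqVneq (t e) v) => [->|_] //=;
    by rewrite ?eqxx; case: (_ \in X); case: (_ \in X).
pose I := [set e | v \in ends e].
have := maxX X' isT; rewrite -(cardsID I (cut X')) -(cardsID I (cut X)).
have -> : cut X' :&: I = incident (R :\: cut X) v.
  apply/setP=> e; rewrite !in_setI cutX' !in_set.
  by case: (e \in R); case: (v \in ends e); case: (s e \in X); case: (t e \in X).
have -> : cut X' :\: I = cut X :\: I.
  apply/setP=> e; rewrite !in_setD cutX' !in_set.
  by case: (e \in R); case: (v \in ends e); case: (s e \in X); case: (t e \in X).
have -> : cut X :&: I = incident (cut X) v by apply/setP=> e; rewrite !in_set.
by rewrite /= leq_add2r.
Qed.

(** Starting from [M], where any colours are compatible, the other edges of [P] are added one by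
    one; each has fewer neighbours in [P] than [Q] has colours. *)
Lemma greedy_extension (C : finType) (Q : {set C}) M P (p : edge G -> C) :
  matching M -> M \subset P -> {in M, forall e, p e \in Q} ->
  {in P, forall e, #|[set f in P | adjacent_edges e f]| < #|Q|} ->
  exists c : edge G -> C,
    [/\ {in P &, forall e f, adjacent_edges e f -> c e != c f},
        {in P, forall e, c e \in Q} & {in M, c =1 p}].
Proof.
move=> mM + pQ; have [n] := ubnP #|P|; elim: n P => // n IHn P ltPn sMP ltQ.
have [sPM|/subsetPn[e eP eM]] := boolP (P \subset M).
  exists p; split=> //; last by move=> e /(subsetP sPM)/pQ.
  by move=> e f /(subsetP sPM) eM /(subsetP sPM) fM adj; have := mM e f eM fM; rewrite adj.
have sDP : P :\ e \subset P by apply: subsetDl.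
have ltD : #|P :\ e| < n by move: ltPn; rewrite (cardsD1 e P) eP.
have [||c [cP cQ cM]] := IHn (P :\ e) ltD.
- by rewrite subsetD1 sMP.
- move=> f /(subsetP sDP) fP; apply: leq_ltn_trans (ltQ f fP).
  apply: subset_leq_card; apply/subsetP=> g; rewrite !inE -andbA.
  by case/and3P=> _ -> ->.
have /subsetPn[k kQ kN] : ~~ (Q \subset c @: [set f in P | adjacent_edges e f]).
  apply: contraL (ltQ e eP) => /subset_leq_card le; rewrite -leqNgt.
  exact: leq_trans le (leq_imset_card _ _).
have kP f : f \in P -> adjacent_edges e f -> c f != k.
  by move=> fP adj; apply: contraNneq kN => <-; apply: imset_f; rewrite inE fP.
exists (fun f => if f == e then k else c f); split.
- move=> f g fP gP; case: (eqVneq f e) => [->|fe]; case: (eqVneq g e) => [->|ge].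
  + by rewrite /adjacent_edges eqxx.
  + by rewrite eq_sym; apply: kP.
  + by rewrite adjacent_edges_sym; apply: kP.
  + by apply: cP; rewrite !inE ?fe ?ge.
- by move=> f fP; case: (eqVneq f e) => // fe; apply: cQ; rewrite !inE fe.
- by move=> f fM; case: (eqVneq f e) => [fe|_]; [rewrite -fe fM in eM|apply: cM].
Qed.

(** The [2] accounts for [e] itself, counted once at each end. *)
Lemma card_adjacent_edges P e x y : e \in P -> ends e = [set x; y] ->
  #|[set f in P | adjacent_edges e f]| + 2 <= #|incident P x| + #|incident P y|.
Proof.
move=> eP exy; rewrite (cardsD1 e (incident P x)) (cardsD1 e (incident P y)).
rewrite !inE eP exy !inE !eqxx orbT /= addnACA addnC leq_add2l.
apply: leq_trans (leq_card_setU _ _); apply: subset_leq_card.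
apply/subsetP=> f; rewrite !inE => /andP[fP /andP[ef /existsP[v]]].
rewrite exy !inE fP [f == e]eq_sym ef /= => /andP[/orP[] /eqP -> ->] //.
by rewrite orbT.
Qed.

End Multigraph.

(** * Assembling the extension of the precolouring *)

Theorem theorem1p6 (G : multigraph) (M : {set edge G}) (p : edge G -> nat)
  (hM : matching M)
  (hp : forall e : edge G, e \in M -> p e \in palette G) :
  exists c : edge G -> nat,
    [/\ proper_edge_colouring c,
        forall e : edge G, c e \in palette G
      & forall e : edge G, e \in M -> c e = p e].
Proof.
have [S [X [a [b [sSR ab abX bal]]]]] := balanced_cut (~: M).
pose D := max_degree G; pose K := (3 * D + 1) %/ 2.
pose P := ~: S.
have sMP : M \subset P by rewrite -(setCK M) setCS.
(* If [v] meets [m] edges of [M], [u] uncut and [s] cut ones, then [m <= 1], [u <= s] and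
   [m + u + s <= D], so [2m + 2u <= m + D <= D + 1]. *)
have degP v : 2 * #|incident P v| <= D + 1 /\ #|incident P v| + #|incident S v| <= D.
  have := card_incident_setD v sMP; have := card_incident_setD v (subsetT S).
  have := card_incident_le_max_degree v; have := card_incident_matching v hM.
  have := bal v; rewrite setTD -/P.
  rewrite (_ : ~: M :\: S = P :\: M) ?setDE 1?setIC // -/D; lia.
(* Colours are ordinals up to [K]; excluding [ord0] leaves exactly the palette. *)
pose Q : {set 'I_K.+1} := [set~ ord0].
have cardQ : #|Q| = K by rewrite cardsC1 card_ord.
have KE : K = D + (D + 1) %/ 2 by rewrite /K; lia.
have QP (k : 'I_K.+1) : k \in Q -> (k : nat) \in palette G.
  by rewrite !inE -/D -/K leq_ord andbT lt0n.
have pK e : e \in M -> 0 < p e <= K by move/hp; rewrite inE.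
have [||c [cP cQ cM]] :=
    @greedy_extension G _ Q M P (fun e => inord (p e)) hM sMP.
- by move=> e /pK/andP[p0 pe]; rewrite !inE -val_eqE /= inordK // -lt0n.
(* At most [(D + 1) - 2] edges of [P] are adjacent to [e], fewer than [K]. *)
- move=> e eP; have := card_adjacent_edges eP (ab e); rewrite cardQ KE.
  have [] := degP (a e); have [] := degP (b e); lia.
pose L e := [set k in Q | k \notin c @: incident P (a e)
                          & k \notin c @: incident P (b e)].
have [|c' [cL cS]] := @bipartite_list_colouring _ _ _ a b _ ord0 L S.
  move=> e eS.
  have la : #|fibre a S (a e)| <= #|incident S (a e)|.
    apply: subset_leq_card; apply/subsetP=> f; rewrite !inE => /andP[-> /eqP <-].
    by rewrite ab !inE eqxx.
  have lb : #|fibre b S (b e)| <= #|incident S (b e)|.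
    apply: subset_leq_card; apply/subsetP=> f; rewrite !inE => /andP[-> /eqP <-].
    by rewrite ab !inE eqxx orbT.
  have : #|Q| <= #|L e| + #|incident P (a e)| + #|incident P (b e)|.
    have sQ : Q \subset L e :|: c @: incident P (a e) :|: c @: incident P (b e).
      apply/subsetP=> k kQ; rewrite 2!in_setU inE kQ /=.
      by case: (k \in _); case: (k \in _).
    apply: leq_trans (subset_leq_card sQ) _.
    apply: leq_trans (leq_card_setU _ _) _; apply: leq_add (leq_imset_card _ _).
    apply: leq_trans (leq_card_setU _ _) _; apply: leq_add (leq_imset_card _ _).
    exact: leqnn.
  rewrite cardQ => leL.
  have {}leL : K - #|incident P (a e)| - #|incident P (b e)| <= #|L e| by lia.
  apply: leq_trans leL.
  (* As [P] has at most [(D + 1) %/ 2] edges at [b e], the list keeps at least [D] minus the number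
     at [a e], which bounds the cut edges at [a e]; likewise with the ends exchanged. *)
  have [] := degP (a e); have [] := degP (b e); lia.
have LP e f : e \in S -> f \in P -> adjacent_edges e f -> c' e != c f.
  move=> eS fP /andP[_ /existsP[v /andP[ve vf]]].
  have := cL e eS; rewrite !inE => /and3P[_ na nb].
  move: ve; rewrite ab !inE => /orP[] /eqP ve.
    by apply: contraNneq na => ->; apply: imset_f; rewrite inE fP -ve.
  by apply: contraNneq nb => ->; apply: imset_f; rewrite inE fP -ve.
have inP e : e \notin S -> e \in P by rewrite inE.
exists (fun e => if e \in S then c' e : nat else c e : nat); split.
- move=> e f adj; case: ifPn => eS; case: ifPn => fS => /val_inj/eqP; apply/negP.
  + case/andP: adj => ef /existsP[v]; rewrite !ab !inE => /andP[ve vf].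
    (* Cut edges have their [a]-end in [X] and their [b]-end outside, so a common vertex is the same
       kind of end for both. *)
    apply: cS => //; have /andP[ea eb] := abX e eS; have /andP[fa fb] := abX f fS.
    case/orP: ve vf => /eqP -> /orP[] /eqP E; rewrite ?E ?eqxx ?orbT //.
      by rewrite E (negPf fb) in ea.
    by rewrite E fa in eb.
  + by apply: LP => //; apply: inP.
  + by rewrite eq_sym; apply: LP; rewrite ?inP // adjacent_edges_sym.
  + by apply: cP => //; apply: inP.
- move=> e; case: ifPn => eS; apply: QP; last by apply: cQ; apply: inP.
  by have := cL e eS; rewrite inE => /andP[].
- move=> e eM; have := subsetP sMP e eM; rewrite inE => /negPf ->.
  by rewrite cM // inordK // ltnS; case/andP: (pK e eM).
Qed.
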